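(* Let $q$ be a prime power, $m\ge2$ an integer, and $g(x)=x^m+\sum_{i=2}^{m-1}a_ix^i$ with $a_i\in\mathbb{F}_q$. Let $\delta_i\in\mathbb{F}_{q^2}$ with $\delta_i^{q+1}=1$, $s(x)=x^q+\delta_ix$, and let $\lambda$ be a nonzero element of the image of $s$. If $g(x)+\gamma x$ is a permutation polynomial of $\mathbb{F}_q$ for some $\gamma\in\mathbb{F}_q^*$, then there exists a linearized polynomial $L(x)$ over $\mathbb{F}_{q^2}$ of rank $2$ with $L(\ker s)$ not contained in the $\mathbb{F}_q$-span of $\lambda^m$ such that $s(x)^m+\sum_{i=2}^{m-1}\lambda^{m-i}a_is(x)^i+L(x)$ is a (normalized) permutation polynomial of $\mathbb{F}_{q^2}$. Moreover, if there are $k$ distinct $\gamma\in\mathbb{F}_q^*$ such that $g(x)+\gamma x$ is a permutation polynomial of $\mathbb{F}_q$, then there are $kq^2(q-1)$ distinct rank-$2$ linearized polynomials $L(x)$ with $L(\ker s)$ not contained in the $\mathbb{F}_q$-span of $\lambda^m$ such that $s(x)^m+\sum_{i=2}^{m-1}\lambda^{m-i}a_is(x)^i+L(x)$ is a permutation polynomial of $\mathbb{F}_{q^2}$.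
   Context: A linearized polynomial over $\mathbb{F}_{q^2}$ is $L(x)=\alpha_1x^q+\alpha_0x$ with $\alpha_0,\alpha_1\in\mathbb{F}_{q^2}$; its rank, kernel and image are those of the $\mathbb{F}_q$-linear evaluation map on $\mathbb{F}_{q^2}$. A permutation polynomial of a finite field is one whose evaluation map is a bijection of that field; ''normalized'' means monic and mapping $0$ to $0$. *)

(* Defs.v *)
(* World: Mathematical Components.

   Throughout, K is the field with q = #|K| elements and E is an extension of
   K; the quadratic case is the condition \dim {:E} = 2. *)
From HB Require Import structures.
From mathcomp Require Import all_boot all_order all_fingroup all_algebra.
From mathcomp Require Import all_solvable all_field.
Set Implicit Arguments.
Unset Strict Implicit.
Unset Printing Implicit Defensive.
Import GRing.Theory.
Local Open Scope ring_scope.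

Definition permutation_poly (F : fieldType) (p : {poly F}) : Prop :=
  bijective (fun x : F => p.[x]).

Definition normalized (F : fieldType) (p : {poly F}) : Prop :=
  p \is monic /\ p.[0] = 0.

Definition linearized (K : finFieldType) (E : fieldExtType K)
    (L : {poly E}) : Prop :=
  exists a1 a0 : E, L = a1 *: 'X^#|K| + a0 *: 'X.

(* [linfun f] agrees with f only when f is K-linear; [lin_evalE] below shows
   that [lin_eval L] is the evaluation map of L whenever L is linearized. *)
Definition lin_eval (K : finFieldType) (E : fieldExtType K) (L : {poly E}) :
    'End(E) :=
  linfun (fun x : E => L.[x]).

Definition lrank (K : finFieldType) (E : fieldExtType K) (L : {poly E}) : nat :=
  \dim (limg (lin_eval L)).

Definition exactly (T : eqType) (n : nat) (P : T -> Prop) : Prop :=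
  exists r : seq T, [/\ uniq r, size r = n & forall x, x \in r <-> P x].

Definition g_poly (K : fieldType) (m : nat) (a : nat -> K) : {poly K} :=
  'X^m + \sum_(2 <= i < m) a i *: 'X^i.

Definition s_poly (K : finFieldType) (E : fieldExtType K) (delta : E) :
    {poly E} :=
  'X^#|K| + delta *: 'X.

Definition f_poly (K : finFieldType) (E : fieldExtType K) (m : nat)
    (a : nat -> K) (s : {poly E}) (lambda : E) (L : {poly E}) : {poly E} :=
  s ^+ m + \sum_(2 <= i < m) (lambda ^+ (m - i) * (a i)%:A) *: s ^+ i + L.

Lemma linearized_linear (K : finFieldType) (E : fieldExtType K) (L : {poly E}) :
  linearized L -> linear (fun x : E => L.[x]).
Proof.
move=> [a1 [a0 ->]] c x y.
have [p p_pr pK] := finPcharP K.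
have pE : p \in [pchar E] by rewrite (fmorph_pchar (in_alg E)).
have qE : [pchar E].-nat #|K|.
  have := abelem_pgroup (fin_ring_pchar_abelem pK).
  by rewrite /pgroup cardsT (eq_pnat _ (pcharf_eq pE)).
rewrite !hornerE exprDn_pchar // exprZn expf_card !mulrDr -!scalerAr scalerDr.
by rewrite !addrA; congr (_ + _); rewrite addrAC.
Qed.

Lemma lin_evalE (K : finFieldType) (E : fieldExtType K) (L : {poly E}) :
  linearized L -> forall x, lin_eval L x = L.[x].
Proof.
move=> /linearized_linear linL x.
pose ev := GRing.isLinear.Build K E E *:%R (fun y : E => L.[y]) linL.
pose evL : {linear E -> E} := HB.pack (fun y : E => L.[y]) ev.
exact: (lfunE evL x).
Qed.

Lemma s_poly_linearized (K : finFieldType) (E : fieldExtType K) (delta : E) :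
  linearized (s_poly delta).
Proof. by exists 1, delta; rewrite scale1r. Qed.

(* Main.v *)
(* Since delta ^+ q.+1 = 1, every value y of s satisfies y ^+ q = delta ^+ q * y,
   so the image of s is the K-line through lambda and ker s is a line <[v]>.
   Pick w with s(w) = lambda and put M = lambda ^+ m. A linearized L amounts to
   a free choice of L(v) and L(w). If L(v) is not in <[M]>, write
   L(w) = gamma M + d L(v); then
     f(t w + u v) = (g(t) + gamma t) M + (u + t d) L(v),
   so f permutes E iff g + gamma X permutes K, and L has rank 2 iff gamma != 0.
   The count is: k values of gamma, q of d, and q^2 - q of L(v). *)
Require Import Defs.
From HB Require Import structures.
From mathcomp Require Import all_boot all_order all_fingroup all_algebra.
From mathcomp Require Import all_solvable all_field.
Set Implicit Arguments.
Unset Strict Implicit.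
Unset Printing Implicit Defensive.
Import GRing.Theory.
Local Open Scope ring_scope.


Section TwoDimensional.

Variables (K : fieldType) (V : vectType K) (u v : V).
Hypotheses (u0 : u != 0) (vNu : v \notin <[u]>%VS).

Lemma line_notin_free (x y : K) : x *: u + y *: v = 0 -> x = 0 /\ y = 0.
Proof.
have [-> | y0] := eqVneq y 0.
  by rewrite scale0r addr0 => /eqP; rewrite scaler_eq0 (negPf u0) orbF => /eqP.
move=> /eqP; rewrite addrC addr_eq0 => /eqP yv; case/negP: vNu.
by rewrite -(scalerK y0 v) yv memvZ // memvN memvZ // memv_line.
Qed.

Lemma line_notin_inj (x y x' y' : K) :
  x *: u + y *: v = x' *: u + y' *: v -> x = x' /\ y = y'.
Proof.
move=> /eqP; rewrite -subr_eq0 opprD addrACA -!scalerBl => /eqP.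
by case/line_notin_free=> /eqP; rewrite subr_eq0 => /eqP -> /eqP;
  rewrite subr_eq0 => /eqP ->.
Qed.

Lemma dim2_decomp (z : V) :
  \dim {:V} = 2%N -> exists x y : K, z = x *: u + y *: v.
Proof.
move=> dimV.
have v0 : v != 0 by apply: contraNneq vNu => ->; apply: mem0v.
have cap0 : (<[u]> :&: <[v]> = 0)%VS.
  apply/eqP; rewrite -subv0; apply/subvP=> y /memv_capP[/vlineP[c ->]].
  case/vlineP=> d /eqP; rewrite -subr_eq0 -scaleNr => /eqP.
  by case/line_notin_free=> -> _; rewrite scale0r mem0v.
have full : (<[u]> + <[v]> = fullv)%VS.
  by apply/eqP; rewrite eqEdim subvf dimV (dimv_disjoint_sum cap0) !dim_vline
    u0 v0.
have /memv_addP[_ /vlineP[x ->] [_ /vlineP[y ->] ->]] : z \in (<[u]> + <[v]>)%VS.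
  by rewrite full memvf.
by exists x, y.
Qed.

End TwoDimensional.

Lemma notin_line_exists (K : fieldType) (V : vectType K) (u : V) :
  \dim {:V} = 2%N -> exists v : V, v \notin <[u]>%VS.
Proof.
move=> dimV; have /subvPn[v _ vNu] : ~~ (fullv <= <[u]>)%VS.
  by apply/negP=> /dimvS; rewrite dimV dim_vline; case: (u != 0).
by exists v.
Qed.

Section Linearized.

Variables (K : finFieldType) (E : fieldExtType K).

Lemma linearizedD_horner (L : {poly E}) (t u : K) (w v : E) :
  linearized L -> L.[t *: w + u *: v] = t *: L.[w] + u *: L.[v].
Proof. by move=> linL; rewrite -!(lin_evalE linL) linearD !linearZ. Qed.

Lemma injective_permutation (p : {poly E}) :
  injective (horner p) -> permutation_poly p.
Proof. by move=> inj_p; apply: (@injF_bij (finvect_type E)). Qed.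

Lemma frobenius_fixed (x : E) : x ^+ #|K| = x -> exists c : K, x = c *: 1.
Proof.
move=> xK; apply/vlineP; rewrite -[<[1]>%VS]/(1%VS).
by have := Fermat's_little_theorem 1%AS x; rewrite dimv1 expn1 xK eqxx.
Qed.

Section SPoly.

Variables (delta lambda w : E).
Hypotheses (dimE : \dim {:E} = 2%N) (deltaN : delta ^+ #|K|.+1 = 1).
Let s := s_poly delta.
Hypotheses (lambda0 : lambda != 0) (sw : s.[w] = lambda).

Lemma s_polyX (x : E) : s.[x] ^+ #|K| = delta ^+ #|K| * s.[x].
Proof.
have xq : x ^+ #|K| ^+ #|K| = x.
  rewrite -exprM mulnn.
  by have := Fermat's_little_theorem fullv x; rewrite dimE memvf => /esym/eqP.
have sE y : s.[y] = y ^+ #|K| + delta * y by rewrite !hornerE.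
(* The Frobenius commutes with sums because it is evaluation of 'X^q. *)
have linF : linearized ('X^#|K| : {poly E}).
  by exists 1, 0; rewrite scale1r scale0r addr0.
have := linearizedD_horner 1 1 (x ^+ #|K|) (delta * x) linF.
rewrite !hornerXn !scale1r sE => ->.
by rewrite xq exprMn mulrDr mulrA -exprSr deltaN mul1r addrC.
Qed.

Lemma s_poly_line (x : E) : exists t : K, s.[x] = t *: lambda.
Proof.
have [|t Et] := @frobenius_fixed (s.[x] / lambda).
  have d0 : delta ^+ #|K| != 0.
    apply: contraTneq (oner_neq0 E) => d0.
    by rewrite -deltaN exprSr d0 mul0r eqxx.
  by rewrite expr_div_n -sw !s_polyX -mulf_div divff // mul1r.
by exists t; rewrite -(mul1r lambda) scalerAl -Et divfK.
Qed.

Lemma s_poly_ker : exists v : E,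
  [/\ v != 0, s.[v] = 0, lker (lin_eval s) = <[v]>%VS & w \notin <[v]>%VS].
Proof.
have linS : linearized s := s_poly_linearized delta.
have img1 : (limg (lin_eval s) <= <[lambda]>)%VS.
  apply/subvP=> _ /memv_imgP[x _ ->]; rewrite (lin_evalE linS).
  by have [t ->] := s_poly_line x; rewrite memvZ ?memv_line.
have imgl : (<[lambda]> <= limg (lin_eval s))%VS.
  rewrite -memvE -sw -(lin_evalE linS); exact: memv_img (memvf w).
have dim_img : \dim (limg (lin_eval s)) = 1%N.
  have /eqP -> : (limg (lin_eval s) == <[lambda]>)%VS.
    by rewrite eqEsubv img1 imgl.
  by rewrite dim_vline lambda0.
have := limg_ker_dim (lin_eval s) fullv; rewrite capfv dim_img dimE addn1.
case=> dim_ker.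
pose v := vpick (lker (lin_eval s)).
have v0 : v != 0 by rewrite vpick0 -dimv_eq0 dim_ker.
have kv : v \in lker (lin_eval s) by apply: memv_pick.
have sv : s.[v] = 0 by apply/eqP; rewrite -(lin_evalE linS) -memv_ker.
exists v; split=> //.
  apply/eqP; rewrite eq_sym eqEdim -memvE kv dim_ker dim_vline v0 //.
apply: contra lambda0 => /vlineP[c wE].
by rewrite -sw wE -(lin_evalE linS) linearZ /= (lin_evalE linS) sv scaler0.
Qed.

End SPoly.

Lemma f_poly_horner (m : nat) (a : nat -> K) (lambda : E) (s L : {poly E})
    (x : E) (t : K) :
  s.[x] = t *: lambda ->
  (f_poly m a s lambda L).[x] = (g_poly m a).[t] *: lambda ^+ m + L.[x].
Proof.
move=> sx; rewrite /f_poly /g_poly !hornerD !horner_sum horner_exp sx hornerXn.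
rewrite exprZn scalerDl scaler_suml; congr (_ + _ + _).
apply: eq_big_nat => i /andP[_ ltim]; rewrite !hornerE sx exprZn.
by rewrite -[in RHS](subnK (ltnW ltim)) exprD -scalerA mulrAC -!scalerAr mulr1.
Qed.

Lemma f_poly_normalized (m : nat) (a : nat -> K) (delta lambda : E)
    (L : {poly E}) :
  (2 <= m)%N -> linearized L ->
  normalized (f_poly m a (s_poly delta) lambda L).
Proof.
move=> m2 [a1 [a0 EL]]; have q1 : (1 < #|K|)%N := finNzRing_gt1 K.
have szd : (size (delta *: 'X : {poly E}) < size ('X^#|K| : {poly E}))%N.
  by rewrite size_polyXn (leq_ltn_trans (size_scale_leq _ _)) ?size_polyX.
have size_s : size (s_poly delta) = #|K|.+1.
  by rewrite size_polyDl // size_polyXn.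
have mon_s : s_poly delta \is monic.
  by rewrite monicE lead_coefDl // lead_coefXn.
have size_sX i : size (s_poly delta ^+ i) = (#|K| * i).+1.
  rewrite -[LHS]prednK ?size_exp ?size_s //.
  by rewrite size_poly_gt0 monic_neq0 // monic_exp.
split; last first.
  have lin0 (p : {poly E}) : linearized p -> p.[0] = 0.
    by move=> /lin_evalE <-; rewrite linear0.
  have s0 : (s_poly delta).[0] = 0 *: lambda.
    by rewrite scale0r lin0 //; apply: s_poly_linearized.
  rewrite (f_poly_horner _ _ _ s0) (lin0 _ (ex_intro _ a1 (ex_intro _ a0 EL))).
  rewrite /g_poly hornerD horner_sum hornerXn expr0n gtn_eqF ?(ltnW m2) //.
  rewrite big_nat big1 ?addr0 ?scale0r // => i /andP[i2 _].
  by rewrite hornerZ hornerXn expr0n gtn_eqF ?(ltnW i2) ?mulr0.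
rewrite monicE /f_poly -addrA lead_coefDl; first by apply: monic_exp.
rewrite size_sX ltnS (leq_trans (size_polyD _ _)) // geq_max; apply/andP; split.
  apply: leq_trans (size_sum _ _ _) _; rewrite big_nat.
  apply/bigmax_leqP_seq=> i _ /andP[_ ltim].
  by rewrite (leq_trans (size_scale_leq _ _)) // size_sX ltn_mul2l ltim (ltnW q1).
apply: (@leq_trans #|K|.+1); last first.
  by rewrite (@leq_trans (#|K| * 2)) ?leq_mul2l ?m2 ?orbT // muln2 -addnn -addn1
    leq_add2l ltnW.
rewrite EL (leq_trans (size_polyD _ _)) // geq_max.
rewrite !(leq_trans (size_scale_leq _ _)) ?size_polyXn ?size_polyX //.
by rewrite ltnS ltnW.
Qed.

Section Parametrization.

Variables (m : nat) (a : nat -> K) (delta lambda v w : E).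
Let s := s_poly delta.
Let M := lambda ^+ m.
Hypotheses (dimE : \dim {:E} = 2%N) (lambda0 : lambda != 0).
Hypotheses (sw : s.[w] = lambda) (sv : s.[v] = 0) (v0 : v != 0).
Hypothesis wNv : w \notin <[v]>%VS.
Hypothesis ker_s : lker (lin_eval s) = <[v]>%VS.

Lemma coordinates (x : E) : exists t u : K, x = t *: w + u *: v.
Proof.
by have [u [t ->]] := dim2_decomp v0 wNv x dimE; exists t, u; rewrite addrC.
Qed.

Lemma coordinates_inj (t u t' u' : K) :
  t *: w + u *: v = t' *: w + u' *: v -> t = t' /\ u = u'.
Proof.
by rewrite !(addrC (_ *: w)) => /(line_notin_inj v0 wNv)[-> ->].
Qed.

Lemma lpower_neq0 : M != 0.
Proof. exact: expf_neq0. Qed.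

Lemma image_ker_line (L : {poly E}) : linearized L ->
  (lin_eval L @: lker (lin_eval s) <= <[M]>)%VS = (L.[v] \in <[M]>%VS).
Proof. by move=> linL; rewrite ker_s limg_line -memvE lin_evalE. Qed.

Section Image.

Variables (L : {poly E}) (gamma d : K).
Hypotheses (linL : linearized L) (LvM : L.[v] \notin <[M]>%VS).
Hypothesis Lw : L.[w] = gamma *: M + d *: L.[v].

Lemma L_coordinates (t u : K) :
  L.[t *: w + u *: v] = (gamma * t) *: M + (u + t * d) *: L.[v].
Proof.
rewrite linearizedD_horner // Lw scalerDr !scalerA (mulrC t) scalerDl -addrA.
by congr (_ + _); rewrite addrC.
Qed.

Lemma f_coordinates (t u : K) :
  (f_poly m a s lambda L).[t *: w + u *: v] =
  (g_poly m a + gamma *: 'X).[t] *: M + (u + t * d) *: L.[v].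
Proof.
have sx : s.[t *: w + u *: v] = t *: lambda.
  rewrite linearizedD_horner ?sw ?sv ?scaler0 ?addr0 //.
  exact: s_poly_linearized.
rewrite (f_poly_horner _ _ _ sx) L_coordinates hornerD hornerZ hornerX.
by rewrite addrA -scalerDl.
Qed.

Lemma lrank2E : lrank L = 2%N <-> gamma != 0.
Proof.
apply: (@iff_trans _ (lker (lin_eval L) = 0%VS)).
  have := limg_ker_dim (lin_eval L) fullv; rewrite capfv dimE -/(lrank L).
  move=> rank_nullity; split=> [r2 | ker0].
    by apply/eqP; rewrite -dimv_eq0 -(eqn_add2r (lrank L)) rank_nullity r2.
  by move: rank_nullity; rewrite ker0 dimv0.
split=> [ker0 | gamma0].
  apply: contraNneq wNv => gamma0.
  have : w - d *: v \in lker (lin_eval L).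
    rewrite memv_ker lin_evalE // -scaleNr -[w]scale1r L_coordinates gamma0.
    by rewrite mul0r mul1r addNr !scale0r addr0.
  by rewrite ker0 memv0 subr_eq0 => /eqP ->; rewrite memvZ ?memv_line.
apply/eqP; rewrite -subv0; apply/subvP=> x; have [t [u ->]] := coordinates x.
rewrite memv_ker lin_evalE // L_coordinates => /eqP.
case/(line_notin_free lpower_neq0 LvM)=> /eqP.
rewrite mulf_eq0 (negPf gamma0) => /eqP ->.
by rewrite mul0r addr0 => ->; rewrite !scale0r addr0 mem0v.
Qed.

Lemma permutation_f_polyE :
  permutation_poly (f_poly m a s lambda L) <->
  permutation_poly (g_poly m a + gamma *: 'X).
Proof.
split=> /bij_inj injp.
  apply: injF_bij => t t' Ett'.
  have [] // := @coordinates_inj t (- (t * d)) t' (- (t' * d)).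
  by apply: injp; rewrite !f_coordinates Ett' !addNr.
apply: injective_permutation => x x'.
have [t [u ->]] := coordinates x; have [t' [u' ->]] := coordinates x'.
rewrite !f_coordinates => /(line_notin_inj lpower_neq0 LvM)[/injp ->].
by move/addIr ->.
Qed.

End Image.

Definition interp_poly (A B : E) : {poly E} :=
  ((B - A / v * w) / lambda) *: s + (A / v) *: 'X.

Lemma interp_poly_linearized (A B : E) : linearized (interp_poly A B).
Proof.
exists ((B - A / v * w) / lambda), ((B - A / v * w) / lambda * delta + A / v).
by rewrite /interp_poly scalerDr scalerA scalerDl addrA.
Qed.

Lemma interp_poly_v (A B : E) : (interp_poly A B).[v] = A.
Proof. by rewrite hornerD !hornerZ sv mulr0 add0r hornerX divfK. Qed.

Lemma interp_poly_w (A B : E) : (interp_poly A B).[w] = B.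
Proof. by rewrite hornerD !hornerZ sw hornerX divfK // subrK. Qed.

Lemma linearized_interp (L : {poly E}) :
  linearized L -> L = interp_poly L.[v] L.[w].
Proof.
move=> [a1 [a0 ->]]; pose b0 := a0 - a1 * delta.
have -> : a1 *: 'X^#|K| + a0 *: 'X = a1 *: s + b0 *: 'X.
  by rewrite scalerDr scalerA -addrA -scalerDl subrKC.
rewrite /interp_poly !hornerD !hornerZ !hornerX sv sw mulr0 add0r mulfK //.
by rewrite addrK mulfK.
Qed.

Variable mu : E.
Hypothesis muNM : mu \notin <[M]>%VS.

Definition param_v (e h : K) : E := e *: M + h *: mu.

Definition param_poly (p : (K * K) * (K * K)) : {poly E} :=
  let A := param_v p.2.1 p.2.2 in interp_poly A (p.1.1 *: M + p.1.2 *: A).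

Lemma param_v_notin (e h : K) : (param_v e h \notin <[M]>%VS) = (h != 0).
Proof.
congr (~~ _); apply/idP/eqP => [/vlineP[c] | ->]; last first.
  by rewrite /param_v scale0r addr0 memvZ ?memv_line.
rewrite -[c *: M]addr0 -(scale0r mu).
by case/(line_notin_inj lpower_neq0 muNM).
Qed.

Lemma param_poly_inj :
  {in [pred p | p.2.2 != 0] &, injective param_poly}.
Proof.
move=> [[c d] [e h]] [[c' d'] [e' h']] h0 _ Epp; rewrite inE /= in h0.
have /= := congr1 (fun L => L.[v]) Epp; rewrite !interp_poly_v => EA.
have /= := congr1 (fun L => L.[w]) Epp; rewrite !interp_poly_w -EA.
case/(line_notin_inj lpower_neq0); first by rewrite param_v_notin.
by move=> /= -> ->; have [/= -> ->] := line_notin_inj lpower_neq0 muNM EA.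
Qed.

Lemma param_polyP (L : {poly E}) :
  [/\ linearized L, lrank L = 2%N,
      ~~ (lin_eval L @: lker (lin_eval s) <= <[M]>)%VS &
      permutation_poly (f_poly m a s lambda L)] <->
  exists p, [/\ p.1.1 != 0, permutation_poly (g_poly m a + p.1.1 *: 'X),
                p.2.2 != 0 & L = param_poly p].
Proof.
split=> [[linL rL + fL] | [[[c d] [e h]] /= [c0 gc h0 EL]]].
  rewrite image_ker_line // => LvM.
  have [c [d Lw]] := dim2_decomp lpower_neq0 LvM L.[w] dimE.
  have [e [h Lv]] := dim2_decomp lpower_neq0 muNM L.[v] dimE.
  exists ((c, d), (e, h)); split=> /=.
  - exact/(lrank2E linL LvM Lw).
  - exact/(permutation_f_polyE linL LvM Lw).
  - by rewrite -(param_v_notin e) /param_v -Lv.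
  by rewrite /param_poly /param_v /= -Lv -Lw; apply: linearized_interp.
have linL : linearized L by rewrite EL; apply: interp_poly_linearized.
have Lv : L.[v] = param_v e h by rewrite EL interp_poly_v.
have LvM : L.[v] \notin <[M]>%VS by rewrite Lv param_v_notin.
have Lw : L.[w] = c *: M + d *: L.[v] by rewrite Lv EL interp_poly_w.
by rewrite image_ker_line //; split=> //;
  [apply/(lrank2E linL LvM Lw) | apply/(permutation_f_polyE linL LvM Lw)].
Qed.

End Parametrization.

End Linearized.

Theorem theorem7 (q : nat) (K : finFieldType) (E : fieldExtType K)
    (m : nat) (a : nat -> K) (delta lambda : E) :
  #|K| = q -> \dim {:E} = 2%N -> (2 <= m)%N ->
  delta ^+ q.+1 = 1 ->
  let g := g_poly m a in
  let s := s_poly delta in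
  lambda != 0 -> lambda \in limg (lin_eval s) ->
  let good_gamma (gamma : K) : Prop :=
    gamma != 0 /\ permutation_poly (g + gamma *: 'X) in
  let good_L (L : {poly E}) : Prop :=
    [/\ linearized L, lrank L = 2%N,
        ~~ (lin_eval L @: lker (lin_eval s) <= <[lambda ^+ m]>)%VS &
        permutation_poly (f_poly m a s lambda L)] in
  ((exists gamma : K, good_gamma gamma) ->
     exists2 L : {poly E}, good_L L & normalized (f_poly m a s lambda L)) /\
  (forall k : nat, exactly k good_gamma ->
     exactly (k * q ^ 2 * (q - 1))%N good_L).

Proof.
move=> qE dimE m2 deltaN g s lambda0 lambda_s good_gamma good_L.
rewrite -qE in deltaN *.
have /memv_imgP[w _] := lambda_s.
rewrite (lin_evalE (s_poly_linearized delta)) => /esym sw.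
have [v [v0 sv ker_s wNv]] := s_poly_ker dimE deltaN lambda0 sw.
have [mu muNM] := notin_line_exists (lambda ^+ m) dimE.
pose param := param_poly m delta lambda v w mu.
have good_LP L : good_L L <-> exists p, [/\ p.1.1 != 0,
    permutation_poly (g + p.1.1 *: 'X), p.2.2 != 0 & L = param p].
  exact: (param_polyP a dimE lambda0 sw sv v0 wNv ker_s muNM).
split=> [[c [c0 gc]] | k [r [uniq_r <- rP]]].
  have gL : good_L (param ((c, 0), (0, 1))).
    by apply/good_LP; exists ((c, 0), (0, 1)); rewrite oner_neq0.
  by exists (param ((c, 0), (0, 1))) => //; case: gL => linL _ _ _;
    apply: f_poly_normalized.
pose D := setX (setX [set c in r] [set: K]) (setX [set: K] [set~ (0 : K)]).
exists [seq param p | p <- enum D]; split=> [||L].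
- rewrite map_inj_in_uniq ?enum_uniq // => p p'.
  rewrite !mem_enum !inE => /andP[_ p0] /andP[_ p'0].
  exact: (param_poly_inj lambda0 sw sv v0 muNM).
- rewrite size_map -cardE !cardsX cardsT cardsC1 cardsE (card_uniqP uniq_r).
  by rewrite -subn1 -mulnn !mulnA.
split=> [/mapP[p + ->] | /good_LP[p [c0 gc h0 ->]]].
  rewrite mem_enum !inE andbT => /andP[/rP[c0 gc] p0].
  by apply/good_LP; exists p.
apply/mapP; exists p => //; rewrite mem_enum !inE h0 /= !andbT.
by apply/rP; split.
Qed.
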